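(* Let $M$ be a sparing monoid, and let $M_\varphi$ be the lifting monoid of $M$ with respect to a lifting function $\varphi$. Then for each positive integer $k$, the monoid $M$ is a $k$-MCD monoid if and only if $M_\varphi$ is a $k$-MCD monoid.
   Context: Notation: $\mathbb{P}$ is the set of primes, $\mathbb{N}_0$ the nonnegative integers, $v_p$ the $p$-adic valuation on $\mathbb{Q}^\times$, $\mathcal{N}$ the class of all additive submonoids of $\mathbb{N}_0$. For a monoid $M$, $M^\bullet$ is its set of nonzero elements. For elements $b,c$ of an additive monoid $H$, $c\mid_H b$ means $b=c+d$ for some $d\in H$. $\langle\cdot\rangle$ denotes the submonoid generated by a set. Sparing monoid: a nontrivial additive submonoid $M$ of $\mathbb{Q}_{\ge 0}$ such that there are infinitely many primes $p$ with $v_p(q)\ge 0$ for all $q\in M^\bullet$. Lifting function (also called lifting map): given a nonempty subset $S\subseteq M^\bullet$ and an injective function $\pi\colon S\to\mathbb{P}$, a lifting function on $M$ is a function $\varphi\colon S\to\mathbb{P}\times\mathcal{N}$, $s\mapsto(\pi(s),N_s)$, such that (i) $v_{\pi(s)}(q)\ge 0$ and $v_{\pi(s)}(s)=0$ for all $s\in S$ and $q\in M^\bullet$; (ii) $\pi(s)\in N_s$ for all $s\in S$. It is tacitly assumed that $N_s\ne\pi(s)\mathbb{N}_0$ for all $s\in S$. Lifting monoid: for $q\in M$ put $M_q:=\frac{q}{\pi(q)}N_q$ if $q\in S$ and $M_q:=q\mathbb{N}_0$ if $q\notin S$. Then $M_\varphi:=\langle\bigcup_{q\in M}M_q\rangle\subseteq\mathbb{Q}_{\ge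 0}$. Maximal common divisors: a common divisor of a nonempty subset $T$ of a monoid $H$ is an element $d\in H$ with $d\mid_H t$ for all $t\in T$. A maximal common divisor (MCD) of $T$ is a common divisor $d$ of $T$ such that for any common divisor $d'\in H$ of $T$, $d\mid_H d'$ implies that $d'-d$ is an invertible element of $H$. For a positive integer $k$, $H$ is a $k$-MCD monoid if every subset $T\subseteq H$ with $|T|=k$ has an MCD in $H$. *)

(* Defs.v *)
From HB Require Import structures.
From mathcomp Require Import all_boot all_order all_algebra.
From mathcomp Require Import boolp classical_sets functions cardinality.

Set Implicit Arguments.
Unset Strict Implicit.
Unset Printing Implicit Defensive.

Import Order.TTheory GRing.Theory Num.Theory.

Local Open Scope classical_set_scope.
Local Open Scope ring_scope.

(* [nmod_closed] is closure under both 0 and +. *)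
Definition submonoid (V : nmodType) (A : set V) : Prop := GRing.nmod_closed (mem A).

Definition nonzeros (V : nmodType) (A : set V) : set V := A `\ 0.

Definition gen_submonoid (V : nmodType) (G : set V) : set V :=
  smallest (@submonoid V) G.

Section Divisibility.
Variables (V : zmodType) (H : set V).

Definition mdvd (c b : V) : Prop := exists2 d, H d & b = c + d.

Definition minvertible (u : V) : Prop := H u /\ exists2 w, H w & u + w = 0.

Definition common_divisor (T : set V) (d : V) : Prop :=
  H d /\ forall t, T t -> mdvd d t.

Definition is_MCD (T : set V) (d : V) : Prop :=
  common_divisor T d /\
  forall d', common_divisor T d' -> mdvd d d' -> minvertible (d' - d).

Definition kMCD (k : nat) : Prop :=
  forall T : set V, T `<=` H -> (T #= `I_k)%card -> exists d, is_MCD T d.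

End Divisibility.

(* Only meaningful for p prime and q != 0: [logn] returns 0 otherwise. *)
Definition padic_val (p : nat) (q : rat) : int :=
  (logn p `|numq q|%N)%:Z - (logn p `|denq q|%N)%:Z.

Definition sparing (M : set rat) : Prop :=
  [/\ submonoid M,
      M `<=` [set q | 0 <= q],
      M <> [set 0] &
      infinite_set
        [set p | prime p /\ forall q, nonzeros M q -> 0 <= padic_val p q]].

(* A function on S with values in pairs (prime, submonoid of nat) is encoded by
   a total function on rat; its values outside S are unconstrained, and
   [lifting_piece] ignores them. *)
Record lifting_function (M S : set rat) (phi : rat -> nat * set nat) : Prop :=
  LiftingFunction {
    lifting_nonempty : S !=set0;
    lifting_sub : S `<=` nonzeros M;
    lifting_prime : forall s, S s -> prime (phi s).1;
    lifting_inj : {in S &, injective (fun s => (phi s).1)};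
    lifting_submonoid : forall s, S s -> submonoid (phi s).2;
    lifting_val_ge0 : forall s q, S s -> nonzeros M q ->
      0 <= padic_val (phi s).1 q;
    lifting_val_eq0 : forall s, S s -> padic_val (phi s).1 s = 0;
    lifting_mem : forall s, S s -> (phi s).2 (phi s).1;
    lifting_nontriv : forall s, S s ->
      (phi s).2 <> [set ((phi s).1 * n)%N | n in [set: nat]]
  }.

Definition lifting_piece (S : set rat) (phi : rat -> nat * set nat) (q : rat) :
    set rat :=
  if q \in S then [set q / (phi q).1%:R * n%:R | n in (phi q).2]
  else [set q * n%:R | n in [set: nat]].

Definition lifting_monoid (M S : set rat) (phi : rat -> nat * set nat) :
    set rat :=
  gen_submonoid (\bigcup_(q in M) lifting_piece S phi q).

(* Main.v *)
(* A finite subset of M_phi lies in some G = M + sum_{s in L} (s / pi(s)) N_s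
   with L finite. Two facts make L harmless. First, if a common divisor d of
   elements of G involves a class modulo pi(s) with s outside L, all cofactors
   involve the opposite class, hence also its least representative in N_s, which
   can be moved into d; so MCDs in G and in M_phi coincide for subsets of G.
   Taking L empty, this already shows that M inherits k-MCD from M_phi. Second,
   G is a finite union of translates of M, and a pigeonhole argument carries MCDs
   from M to G. That argument replaces sets by families, whose elements may
   coincide, which costs nothing since a set of at most k elements can be padded
   with multiples of its members. *)

Require Import Defs.
From mathcomp Require Import all_boot all_order all_algebra.
From mathcomp Require Import boolp classical_sets functions cardinality.
From mathcomp Require Import finmap ring lra zify.

Set Implicit Arguments.
Unset Strict Implicit.
Unset Printing Implicit Defensive.

Import Order.TTheory GRing.Theory Num.Theory.

Local Open Scope classical_set_scope.
Local Open Scope ring_scope.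

(** * Submonoids and MCDs in the nonnegative rationals *)

Lemma submonoid0 (V : nmodType) (A : set V) : submonoid A -> A 0.
Proof. by case=> /set_mem. Qed.

Lemma submonoidD (V : nmodType) (A : set V) x y :
  submonoid A -> A x -> A y -> A (x + y).
Proof. by case=> _ AD /mem_set Ax /mem_set Ay; apply/set_mem/AD. Qed.

Lemma submonoidMn (V : nmodType) (A : set V) x n :
  submonoid A -> A x -> A (x *+ n).
Proof.
move=> hA Ax; elim: n => [|n IHn]; first exact: submonoid0.
by rewrite mulrS; apply: submonoidD.
Qed.

Lemma submonoidP (V : nmodType) (A : set V) :
  A 0 -> (forall x y, A x -> A y -> A (x + y)) -> submonoid A.
Proof.
move=> A0 AD; split; first exact: mem_set.
by move=> x y /set_mem Ax /set_mem Ay; apply/mem_set/AD.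
Qed.

Lemma mdvdE (V : zmodType) (H : set V) c b : mdvd H c b <-> H (b - c).
Proof.
split=> [[d Hd ->]|Hbc]; first by rewrite addrC addKr.
by exists (b - c); rewrite // addrC subrK.
Qed.

Definition nonneg_submonoid (H : set rat) :=
  submonoid H /\ H `<=` [set q | 0 <= q].

(** The only invertible element of a monoid of nonnegative rationals is 0, so maximality becomes an
    equality. *)
Lemma is_MCD_nonneg (H T : set rat) d : nonneg_submonoid H ->
  is_MCD H T d <-> common_divisor H T d /\
    forall d', common_divisor H T d' -> H (d' - d) -> d' = d.
Proof.
move=> [hH H0]; split=> -[cd_d maxd]; split=> // d' cd_d'.
  move=> Hd'd; have /mdvdE/(maxd _ cd_d')[_ [w Hw]] := Hd'd.
  by move: (H0 _ Hd'd) (H0 _ Hw) => /=; lra.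
move=> /mdvdE/(maxd _ cd_d')->; rewrite subrr.
by split; [|exists 0; rewrite ?addr0 //]; apply: submonoid0.
Qed.

(** * Families in place of sets, and finite unions of translates *)

Definition family_MCD (H : set rat) k := forall t : 'I_k -> rat,
  (forall i, H (t i)) -> exists d, is_MCD H (range t) d.

Lemma family_MCD_kMCD (H : set rat) k : family_MCD H k -> kMCD H k.
Proof.
move=> famH T TH /[dup] Tk /card_fset_set sizeT.
have Tfin : finite_set T by apply/finite_setP; exists k.
pose t (i : 'I_k) := nth 0 (fset_set T) i.
have [|d dP] := famH t.
  move=> i; apply: TH; rewrite -[T]fset_setK //.
  by apply/mem_nth; rewrite sizeT.
exists d; suff -> : T = range t by [].
rewrite -[LHS]fset_setK //; apply/seteqP; split=> x /=.
  move=> xT; have lt_x : (index x (fset_set T) < k)%N.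
    by rewrite -sizeT index_mem.
  by exists (Ordinal lt_x) => //; rewrite /t /= nth_index.
by move=> [i _ <-]; apply/mem_nth; rewrite sizeT.
Qed.

(* Adding multiples of elements of [s] to [s] does not change its common
   divisors. *)
Lemma pad_seq (H : set rat) (m : rat) (s : seq rat) n :
  nonneg_submonoid H -> H m -> m != 0 -> s != [::] -> uniq s ->
  {in s, forall x, H x} ->
  exists s', [/\ uniq s', size s' = (n + size s)%N, {subset s <= s'} &
    {in s', forall y, exists2 x, x \in s & H (y - x)}].
Proof.
move=> [hH H0] Hm m_neq0 s_neq0 s_uniq sH.
elim: n => [|n [s' [us' ss' sub div]]].
  exists s; split=> // x xs; exists x => //.
  by rewrite subrr; apply: submonoid0.
have s'H y : y \in s' -> H y.
  move=> /div[x xs Hyx]; rewrite -[y](subrK x).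
  by apply: submonoidD => //; apply: sH.
have Hsum (r : seq rat) : {in r, forall x, H x} -> H (\sum_(y <- r) y).
  elim: r => [|y r IHr] rH; first by rewrite big_nil; apply: submonoid0.
  rewrite big_cons; apply: submonoidD => //; first by apply: rH; apply: mem_head.
  by apply: IHr => x xr; apply: rH; rewrite inE xr orbT.
have m_gt0 : 0 < m by rewrite lt_neqAle eq_sym m_neq0; apply: H0.
(* This element exceeds every member of [s'], since [m] is positive and all terms are nonnegative,
   and every member of [s'] divides it. *)
exists ((m + \sum_(y <- s') y) :: s'); split=> /=.
- rewrite us' andbT; apply/negP => in_s'.
  have /H0 /= : H (\sum_(y <- rem (m + \sum_(y <- s') y) s') y).
    by apply: Hsum => x /mem_rem /s'H.
  have : \sum_(y <- s') y = _ := big_rem _ in_s'.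
  by rewrite /=; lra.
- by rewrite ss'.
- by move=> x xs; rewrite inE sub ?orbT.
- move=> y; rewrite inE => /predU1P[->|/div//].
  case: (s) s_neq0 sub => // x r _ sub; exists x; first exact: mem_head.
  have xs' : x \in s' by apply: sub; apply: mem_head.
  rewrite (big_rem _ xs') /= addrCA [x + _]addrC addrK.
  by apply: submonoidD => //; apply: Hsum => z /mem_rem /s'H.
Qed.

Lemma kMCD_family_MCD (H : set rat) k :
  nonneg_submonoid H -> H <> [set 0] -> (0 < k)%N -> kMCD H k ->
  family_MCD H k.
Proof.
move=> hH0 H_nontriv k_gt0 kH t tH; have [hH H0] := hH0.
have [m Hm m_neq0] : exists2 m, H m & m != 0.
  apply: contrapT => noH; apply: H_nontriv; apply/seteqP; split=> x /=.
    by move=> Hx; apply: contrapT => /eqP x_neq0; apply: noH; exists x.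
  by move=> ->; apply: submonoid0.
pose s := undup (codom t).
have mem_s x : (x \in s) = (x \in codom t) by rewrite mem_undup.
have le_sk : (size s <= k)%N.
  by rewrite (leq_trans (size_undup _)) ?size_codom ?card_ord.
have s_neq0 : s != [::].
  have : t (Ordinal k_gt0) \in s by rewrite mem_s codom_f.
  by apply: contraTneq => ->.
have [x|s' [us' ss' sub div]] :=
    pad_seq (k - size s) hH0 Hm m_neq0 s_neq0 (undup_uniq _).
  by rewrite mem_s => /codomP[i ->].
have cdE d : common_divisor H [set` s'] d <-> common_divisor H (range t) d.
  split=> -[Hd dP]; split=> // y.
    by move=> [i _ <-]; apply: dP; apply: sub; rewrite mem_s codom_f.
  move=> /= /div[x]; rewrite mem_s => /codomP[i ->] Hyt; apply/mdvdE.
  have -> : y - d = (y - t i) + (t i - d) by ring.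
  by apply: submonoidD => //; apply/mdvdE/dP; exists i.
have [||d [/cdE cd_d maxd]] := kH [set` s'].
- move=> x /= /div[z]; rewrite mem_s => /codomP[i ->] Hxt.
  by rewrite -[x](subrK (t i)); apply: submonoidD.
- have -> : [set` s'] = [set` [fset x in s']%fset].
    by apply/seteqP; split=> x /=; rewrite inE.
  by apply/card_eq_fsetP; rewrite card_fseq undup_id // ss' subnK.
by exists d; split=> // d' /cdE /maxd.
Qed.

(* If no maximal common divisor existed, common divisors could be enlarged
   forever; but each is coloured by its translate in [A] together with the
   translates of all its cofactors, and within one colour maximality can be
   tested in [H]. Minimising the set of colours met above [d] makes every colour
   of [d] persist above [d]. *)
Lemma family_MCD_finite_extension (H H' : set rat) (A : seq rat) k :
  nonneg_submonoid H -> nonneg_submonoid H' -> H `<=` H' ->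
  (forall x y, H x -> H y -> H' (x - y) -> H (x - y)) ->
  {in A, forall a, H' a} ->
  (forall x, H' x -> exists2 a, a \in A & H (x - a)) ->
  family_MCD H k -> family_MCD H' k.
Proof.
move=> hH hH' HH' subH AH' cover famH t tH'.
have [[hH1 _] [hH'1 _]] := (hH, hH').
pose color := (seq_sub A * {ffun 'I_k -> seq_sub A})%type.
pose has_color d (c : color) := H (d - val c.1) /\
  forall i, H (t i - d - val (c.2 i)).
pose cd d := common_divisor H' (range t) d.
have cdP d : cd d <-> H' d /\ forall i, H' (t i - d).
  split=> -[Hd dP]; split=> //.
    by move=> i; apply/mdvdE/dP; exists i.
  by move=> _ [i _ <-]; apply/mdvdE.
pose colors d : pred color :=
  fun c => `[< exists d', [/\ cd d', H' (d' - d) & has_color d' c] >].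
have colored d : cd d -> exists c, has_color d c.
  move=> /cdP[Hd td].
  have [a aA Ha] := cover _ Hd.
  have /choice[b bP] i : exists b : seq_sub A, H (t i - d - val b).
    by have [b bA Hb] := cover _ (td i); exists (SeqSub bA).
  by exists (SeqSub aA, finfun b); split=> //= i; rewrite ffunE.
have colorsS d d' : H' (d' - d) -> {subset colors d' <= colors d}.
  move=> Hd'd c /asboolP[e [cd_e Hed' ec]]; apply/asboolP; exists e; split=> //.
  have -> : e - d = (e - d') + (d' - d) by ring.
  exact: submonoidD.
have cd0 : cd 0.
  by apply/cdP; split=> [|i]; rewrite ?subr0 //; apply: submonoid0.
pose few n := `[< exists2 d, cd d & #|colors d| = n >].
have ex_few : exists n, few n by exists #|colors 0|; apply/asboolP; exists 0.
case: (ex_minnP ex_few) => n /asboolP[d cd_d dn] nmin.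
have colors_min d' : cd d' -> H' (d' - d) -> {subset colors d <= colors d'}.
  move=> cd_d' Hd'd c cd_c; have sub := colorsS _ _ Hd'd.
  suff /fintype.subsetP : colors d \subset colors d' by apply.
  have /fintype.subsetP sub' := sub.
  rewrite -(subset_leqif_card sub') eqn_leq subset_leq_card //= dn.
  by apply: nmin; apply/asboolP; exists d'.
have [c [dc tdc]] := colored _ cd_d.
pose h := d - val c.1.
(* The cofactors of [d], translated into [H]. They may coincide for different [i], hence the use of
   families. Their MCD [g] in [H] is what [d] still lacks. *)
pose r i := t i - d - val (c.2 i).
have [//|g /(is_MCD_nonneg _ _ hH)[[Hg gr] gmax]] := famH r.
have Hrg i : H (r i - g) by apply/mdvdE/gr; exists i.
have H'c b : H' (val (b : seq_sub A)) by apply: AH'; apply: valP.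
have cd_e : cd (d + g).
  apply/cdP; split=> [|i].
    by case/cdP: cd_d => ? _; apply: submonoidD => //; apply: HH'.
  have -> : t i - (d + g) = (r i - g) + val (c.2 i) by rewrite /r; ring.
  by apply: submonoidD => //; apply: HH'.
exists (d + g); apply/(is_MCD_nonneg _ _ hH'); split=> // d' cd_d' Hd'.
have Hd'd : H' (d' - d).
  have -> : d' - d = d' - (d + g) + g by ring.
  by apply: submonoidD => //; apply: HH'.
have cc : c \in colors d.
  by apply/asboolP; exists d; split=> //; rewrite subrr; apply: submonoid0.
(* The colour [c] of [d] persists above [d'], say at [f]. As [d] and [f] share a colour, [f - d] is
   a common divisor of the [r i] in [H] that [g] divides, so it equals [g], and [d'] is squeezed
   between [d + g] and [f = d + g]. *)
have /asboolP[f [cd_f Hfd' [fc tfc]]] := colors_min _ cd_d' Hd'd _ cc.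
have Hfe : H (f - (d + g)).
  have -> : f - (d + g) = f - val c.1 - (d - val c.1 + g) by ring.
  apply: subH => //; first exact: submonoidD.
  have -> : f - val c.1 - (d - val c.1 + g) = (f - d') + (d' - (d + g)) by ring.
  exact: submonoidD.
have f_eq : f - d = g.
  apply: gmax; last by rewrite -addrA -opprD.
  split=> [|_ [i _ <-]].
    have -> : f - d = f - (d + g) + g by ring.
    exact: submonoidD.
  apply/mdvdE; have -> : r i - (f - d) = t i - f - val (c.2 i) by rewrite /r; ring.
  exact: tfc.
have := hH'.2 _ Hfd'; have := hH'.2 _ Hd'; rewrite /= => ? ?.
by lra.
Qed.

(** * Residue classes and integrality at a prime *)

Lemma least_in_residue_class (Q : set nat) p :
  (forall a b, Q a -> Q b -> (a = b %[mod p])%N) -> Q !=set0 ->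
  exists2 a, Q a & forall b, Q b -> exists c, b = (a + c * p)%N.
Proof.
move=> Qmod [n Qn].
have exQ : exists n, `[< Q n >] by exists n; apply/asboolP.
case: (ex_minnP exQ) => a /asboolP Qa amin; exists a => // b Qb.
have le_ab : (a <= b)%N by apply: amin; apply/asboolP.
have /eqP := Qmod _ _ Qb Qa; rewrite eqn_mod_dvd // => /dvdnP[c bac].
by exists c; rewrite -bac subnKC.
Qed.

(** For prime [p] this is the localisation of the integers at [p]. Allowing any denominator prime to
    [p], not just the reduced one, makes closure under sums immediate. *)
Definition p_integral (p : nat) (q : rat) :=
  exists2 v : nat, ~~ (p %| v)%N & q * v%:R \is a Num.int.

Lemma p_integralD p x y : prime p ->
  p_integral p x -> p_integral p y -> p_integral p (x + y).
Proof.
move=> p_pr [v pv xv] [w pw yw]; exists (v * w)%N.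
  by rewrite Euclid_dvdM // negb_or pv.
have -> : (x + y) * (v * w)%:R = x * v%:R * w%:R + y * w%:R * v%:R :> rat.
  by rewrite natrM; ring.
by rewrite rpredD // rpredM // natr_int.
Qed.

Lemma p_integralN p x : p_integral p x -> p_integral p (- x).
Proof. by case=> v pv xv; exists v; rewrite // mulNr rpredN. Qed.

Lemma p_integralB p x y : prime p ->
  p_integral p x -> p_integral p y -> p_integral p (x - y).
Proof. by move=> p_pr px /p_integralN; apply: p_integralD. Qed.

Lemma p_integralMn p x n : p_integral p x -> p_integral p (x * n%:R).
Proof. by case=> v pv xv; exists v; rewrite // mulrAC rpredM ?natr_int. Qed.

Lemma p_integral_divr p r x : prime p -> prime r -> p != r ->
  p_integral p x -> p_integral p (x / r%:R).
Proof.
move=> p_pr r_pr p_neq_r [v pv xv]; exists (r * v)%N.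
  by rewrite Euclid_dvdM // negb_or pv dvdn_prime2 // p_neq_r.
by rewrite natrM mulrA divfK // pnatr_eq0 -lt0n prime_gt0.
Qed.

Lemma padic_val_ge0_denq p q : prime p -> 0 <= padic_val p q ->
  ~~ (p %| `|denq q|)%N.
Proof.
move=> p_pr; apply: contraL => p_den.
have p_num : ~~ (p %| `|numq q|)%N.
  apply/negP => p_num; have := coprime_num_den q.
  move=> /eqP cop; have := dvdn_gcd p `|numq q| `|denq q|.
  by rewrite cop p_num p_den dvdn1; case: eqP p_pr => // ->.
rewrite /padic_val -ltNge.
have -> : logn p `|numq q| = 0%N.
  by apply/eqP; rewrite -leqn0 leqNgt logn_gt0 mem_primes (negPf p_num) !andbF.
have : (0 < logn p `|denq q|)%N.
  by rewrite logn_gt0 mem_primes p_pr p_den absz_gt0 denq_neq0.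
lia.
Qed.

Lemma padic_val_eq0_numq p q : prime p -> q != 0 -> padic_val p q = 0 ->
  ~~ (p %| `|numq q|)%N.
Proof.
move=> p_pr q_neq0 v0.
have := padic_val_ge0_denq p_pr; move/(_ q); rewrite v0 lexx => /(_ isT) p_den.
apply/negP => p_num; move: v0; rewrite /padic_val.
have -> : logn p `|denq q| = 0%N.
  by apply/eqP; rewrite -leqn0 leqNgt logn_gt0 mem_primes (negPf p_den) !andbF.
have : (0 < logn p `|numq q|)%N.
  by rewrite logn_gt0 mem_primes p_pr p_num absz_gt0 numq_eq0 q_neq0.
lia.
Qed.

Lemma padic_val_ge0_p_integral p q : prime p -> 0 <= padic_val p q ->
  p_integral p q.
Proof.
move=> p_pr /(padic_val_ge0_denq p_pr) p_den; exists `|denq q|%N => //.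
have -> : `|denq q|%:R = (denq q)%:~R :> rat by rewrite -{2}absz_denq.
by rewrite -numqE intr_int.
Qed.

(** After clearing denominators, [p] divides [numq s * n * v] but neither [numq s] nor [v]. *)
Lemma p_integral_dvdn p s n : prime p -> s != 0 -> padic_val p s = 0 ->
  p_integral p (s / p%:R * n%:R) -> (p %| n)%N.
Proof.
move=> p_pr s_neq0 v0 [v pv /intrP[u snv]].
have E : numq s * n%:Z * v%:Z = u * p%:Z * denq s.
  apply: (@intr_inj rat); rewrite !intrM -snv numqE !pmulrn.
  have p0 : p%:R != 0 :> rat by rewrite pnatr_eq0 -lt0n prime_gt0.
  by field.
have : (p %| `|numq s| * n * v)%N.
  have /(congr1 absz) := E; rewrite !abszM !absz_nat => ->.
  by rewrite dvdn_mulr // dvdn_mull.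
rewrite !Euclid_dvdM // (negPf pv) orbF.
by rewrite (negPf (padic_val_eq0_numq p_pr s_neq0 v0)).
Qed.

(* The monoid G of the header: M + sum_{s in L} (s / pi(s)) N_s. *)
Fixpoint layered (M : set rat) (phi : rat -> nat * set nat) (L : seq rat) :
    set rat :=
  if L is s :: L' then
    [set z + s / (phi s).1%:R * n%:R | z in layered M phi L' & n in (phi s).2]
  else M.

(** * Finite layers of the lifting monoid *)

Section Lifting.
Variables (M S : set rat) (phi : rat -> nat * set nat).
Hypotheses (hM : nonneg_submonoid M) (hphi : lifting_function M S phi).

Let p s := (phi s).1.
Let N s := (phi s).2.
Let lifted := lifting_monoid M S phi.
Let G := layered M phi.

Let M0 : M 0. Proof. by apply: submonoid0; apply: hM.1. Qed.

Let MD x y : M x -> M y -> M (x + y).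
Proof. by apply: submonoidD; apply: hM.1. Qed.

Let MMn x n : M x -> M (x * n%:R).
Proof. by move=> Mx; rewrite mulr_natr; apply: submonoidMn => //; apply: hM.1. Qed.

Let M_S s : S s -> M s. Proof. by case/(lifting_sub hphi). Qed.

Let S_neq0 s : S s -> s != 0.
Proof. by case/(lifting_sub hphi) => _ /eqP. Qed.

Let p_prime s : S s -> prime (p s). Proof. exact: (lifting_prime hphi). Qed.

Let pR_neq0 s : S s -> (p s)%:R != 0 :> rat.
Proof. by move=> /p_prime p_pr; rewrite pnatr_eq0 -lt0n prime_gt0. Qed.

Let N_submonoid s : S s -> submonoid (N s).
Proof. exact: (lifting_submonoid hphi). Qed.

Let N0 s : S s -> N s 0%N. Proof. by move=> /N_submonoid/submonoid0. Qed.

Let ND s m n : S s -> N s m -> N s n -> N s (m + n)%N.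
Proof. by move=> /N_submonoid; apply: submonoidD. Qed.

Let NM s k n : S s -> N s n -> N s (k * n)%N.
Proof.
by move=> Ss Nn; elim: k => [|k IHk]; [exact: N0 | rewrite mulSn; exact: ND].
Qed.

Let M_p_integral s q : S s -> M q -> p_integral (p s) q.
Proof.
move=> Ss Mq; apply: padic_val_ge0_p_integral; first exact: p_prime.
have [->|/eqP q_neq0] := eqVneq q 0.
  by rewrite /padic_val logn0 logn1.
by apply: (lifting_val_ge0 hphi).
Qed.

Let pi_neq s t : S s -> S t -> s != t -> p s != p t.
Proof.
move=> Ss St; apply: contra_neq => pst.
by apply: (lifting_inj hphi) => //; apply: mem_set.
Qed.

(** Injectivity of the prime assignment: the piece of [t] only introduces the prime [p t], so [p s]
    detects the piece of [s] alone. *)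
Let piece_p_integral s t n : S s -> S t -> s != t ->
  p_integral (p s) (t / (p t)%:R * n%:R).
Proof.
move=> Ss St st; apply/p_integralMn/p_integral_divr; try exact: p_prime.
  exact: pi_neq.
exact: M_p_integral Ss (M_S St).
Qed.

Let piece_multiple s c : S s -> s / (p s)%:R * (c * p s)%:R = s * c%:R.
Proof. by move=> Ss; rewrite natrM mulrCA divfK ?pR_neq0 // mulrC. Qed.

Let layered_submonoid L : [set` L] `<=` S -> submonoid (G L).
Proof.
elim: L => [|s L IHL] LS; first exact: hM.1.
have Ss : S s by apply: LS; rewrite /= mem_head.
have GL : submonoid (G L).
  by apply: IHL => x /= xL; apply: LS; rewrite /= inE xL orbT.
apply: submonoidP.
  exists 0; first exact: submonoid0.
  by exists 0%N; [exact: N0 | rewrite mulr0 addr0].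
move=> _ _ [x Gx [m Nm <-]] [y Gy [n Nn <-]]; exists (x + y).
  exact: submonoidD.
by exists (m + n)%N; [exact: ND | rewrite natrD; ring].
Qed.

Let sub_consS s L : [set` s :: L] `<=` S -> S s /\ [set` L] `<=` S.
Proof.
move=> LS; split=> [|x /= xL]; apply: LS; rewrite /= ?mem_head //.
by rewrite inE xL orbT.
Qed.

Let layered_cons s L : S s -> G L `<=` G (s :: L).
Proof.
by move=> Ss x Gx; exists x => //; exists 0%N; rewrite ?mulr0 ?addr0 //; exact: N0.
Qed.

Let M_layered L : [set` L] `<=` S -> M `<=` G L.
Proof.
elim: L => [_ x //|s L IHL /sub_consS[Ss LS] x Mx].
by apply: layered_cons => //; apply: IHL.
Qed.

Let layered_piece s L n : [set` L] `<=` S -> s \in L -> N s n ->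
  G L (s / (p s)%:R * n%:R).
Proof.
elim: L => [//|t L IHL] /sub_consS[St LS]; rewrite inE => /predU1P[->|sL] Nn.
  by exists 0; [exact: M_layered | exists n; rewrite ?add0r].
by apply: layered_cons => //; apply: IHL.
Qed.

Let layered_p_integral s L x : [set` L] `<=` S -> S s -> s \notin L -> G L x ->
  p_integral (p s) x.
Proof.
elim: L x => [|t L IHL] x; first by move=> _ Ss _; apply: M_p_integral.
move=> /sub_consS[St LS] Ss; rewrite inE negb_or => /andP[st sL] [z Gz [n _ <-]].
apply: p_integralD; first exact: p_prime; first exact: IHL.
exact: piece_p_integral.
Qed.

(** * The lifting monoid as the union of its layers *)

Let lifted_submonoid : submonoid lifted.
Proof.
apply: submonoidP => [A [hA _]|x y lx ly A hAG]; first exact: submonoid0.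
by apply: submonoidD; [exact: hAG.1 | exact: lx | exact: ly].
Qed.

Let liftedD x y : lifted x -> lifted y -> lifted (x + y).
Proof. exact: (submonoidD lifted_submonoid). Qed.

Let lifted_piece s n : S s -> N s n -> lifted (s / (p s)%:R * n%:R).
Proof.
move=> Ss Nn; apply: sub_gen_smallest; exists s; first exact: M_S.
by rewrite /lifting_piece mem_set //; exists n.
Qed.

Let M_lifted : M `<=` lifted.
Proof.
move=> x Mx; have [Sx|Sx] := pselect (S x).
  (* Write [x] as [x / p x * p x]; the lifting function guarantees that [p x] lies in [N x]. *)
  rewrite -[x](divfK (pR_neq0 Sx)); apply: lifted_piece => //.
  exact: (lifting_mem hphi Sx).
apply: sub_gen_smallest; exists x => //.
by rewrite /lifting_piece memNset //; exists 1%N; rewrite ?mulr1.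
Qed.

Let layered_lifted L : [set` L] `<=` S -> G L `<=` lifted.
Proof.
elim: L => [_|s L IHL /sub_consS[Ss LS] _ [z Gz [n Nn <-]]]; first exact: M_lifted.
apply: liftedD; last exact: lifted_piece.
exact: IHL.
Qed.

(** Quantifying over all lists containing [L0] lets the supports of several elements be merged and
    reordered freely. *)
Let lifted_layered x : lifted x -> exists2 L0 : seq rat, [set` L0] `<=` S &
  forall L : seq rat, [set` L] `<=` S -> {subset L0 <= L} -> G L x.
Proof.
move: x; apply: smallest_sub.
  apply: submonoidP => [|x y [L1 L1S L1x] [L2 L2S L2y]].
    by exists [::] => // L LS _; apply: submonoid0; apply: layered_submonoid.
  exists (L1 ++ L2) => [s /=|L LS sub].
    by rewrite mem_cat => /orP[]; [exact: L1S | exact: L2S].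
  apply: submonoidD; first exact: layered_submonoid.
    by apply: L1x => // s sL; apply: sub; rewrite mem_cat sL.
  by apply: L2y => // s sL; apply: sub; rewrite mem_cat sL orbT.
move=> x [q Mq]; rewrite /lifting_piece.
case: ifPn => [/set_mem Sq [n Nn <-]|_ [n _ <-]].
  exists [:: q] => [s /=|L LS sub]; first by rewrite inE => /eqP ->.
  by apply: layered_piece => //; apply: sub; rewrite mem_head.
by exists [::] => // L LS _; apply: M_layered => //; apply: MMn.
Qed.

Let lifted_nonneg : nonneg_submonoid lifted.
Proof.
split=> // x /lifted_layered[L LS /(_ L LS (fun=> id))].
elim: L x LS => [|s L IHL] x; first by move=> _ /hM.2.
move=> /sub_consS[Ss LS] [z Gz [n _ <-]]; have /= z_ge0 := IHL _ LS Gz.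
by rewrite /= addr_ge0 // mulr_ge0 ?divr_ge0 ?ler0n //; apply/hM.2/M_S.
Qed.

Let layered_nonneg L : [set` L] `<=` S -> nonneg_submonoid (G L).
Proof.
move=> LS; split; first exact: layered_submonoid.
by move=> x /(layered_lifted LS); apply: lifted_nonneg.2.
Qed.

(** * Detecting layers by integrality *)

Let p_integral_piece_dvdn s z n : S s -> p_integral (p s) z ->
  p_integral (p s) (z + s / (p s)%:R * n%:R) -> (p s %| n)%N.
Proof.
move=> Ss pz pzn; apply: (@p_integral_dvdn _ s).
- exact: p_prime.
- exact: S_neq0.
- exact: (lifting_val_eq0 hphi Ss).
have -> : s / (p s)%:R * n%:R = z + s / (p s)%:R * n%:R - z by ring.
by apply: p_integralB => //; apply: p_prime.
Qed.

(** Layers are peeled off one at a time. As [s] does not recur, the rest is integral at [p s], so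
    integrality of [x] forces [p s] to divide [n], and the layer contributes a multiple of [s],
    already in [M]. *)
Let layered_strip L1 L x : [set` L1 ++ L] `<=` S -> uniq (L1 ++ L) ->
  G (L1 ++ L) x -> {in L1, forall s, p_integral (p s) x} -> G L x.
Proof.
elim: L1 x => [//|s L1 IHL] x /= /sub_consS[Ss LS] /andP[sL uL] [z Gz [n Nn <-]] px.
have pz : p_integral (p s) z by apply: layered_p_integral Gz.
have /dvdnP[c nE] : (p s %| n)%N.
  by apply: p_integral_piece_dvdn pz _ => //; apply: px; rewrite mem_head.
apply: IHL => //; last by move=> t tL1; apply: px; rewrite inE tL1 orbT.
apply: submonoidD => //; first exact: layered_submonoid.
by rewrite nE piece_multiple //; apply: M_layered => //; apply: MMn; apply: M_S.
Qed.

(** The membership criterion for [G L]: the finitely many layers of [x] outside [L] can all be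
    stripped. *)
Let lifted_p_integral_layered L x : [set` L] `<=` S -> uniq L -> lifted x ->
  (forall s, S s -> s \notin L -> p_integral (p s) x) -> G L x.
Proof.
move=> LS uL /lifted_layered[L0 L0S GL0] px.
pose L1 := [seq s <- undup L0 | s \notin L].
have L1S : [set` L1 ++ L] `<=` S.
  move=> s /=; rewrite mem_cat mem_filter mem_undup.
  by case/orP => [/andP[_ /L0S]|/LS].
apply: (@layered_strip L1) => //.
- rewrite cat_uniq uL filter_uniq ?undup_uniq //= andbT.
  by apply/hasPn => s sL; rewrite mem_filter sL.
- apply: GL0 => // s sL0; rewrite mem_cat mem_filter mem_undup sL0 andbT.
  by case: (s \in L).
- by move=> s; rewrite mem_filter mem_undup => /andP[sL /L0S Ss]; apply: px.
Qed.

(** * Moving denominators into common divisors *)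

Let lifted_split s x : S s -> lifted x -> exists z n,
  [/\ lifted z, p_integral (p s) z, N s n & x = z + s / (p s)%:R * n%:R].
Proof.
move=> Ss /lifted_layered[L0 L0S GL0].
(* With [s] listed first and removed from the rest, all of the non-integrality at [p s] sits in the
   head layer. *)
pose L := [seq t <- L0 | t != s].
have LS : [set` L] `<=` S.
  by move=> t /=; rewrite mem_filter => /andP[_ /L0S].
have [||z Gz [n Nn <-]] := GL0 (s :: L).
- by move=> t /=; rewrite inE => /predU1P[->|/LS].
- by move=> t tL0; rewrite inE mem_filter tL0 andbT; case: eqP.
exists z, n; split=> //; first exact: layered_lifted Gz.
by apply: layered_p_integral Gz => //; rewrite mem_filter eqxx.
Qed.

(* Every cofactor of [d] involves at least the least element [a] of [N s]
   cancelling the class of [d] modulo [p s], so s / p s * a can be moved into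
   [d]. *)
Let clear_denominator s T d : S s -> (forall t, T t -> p_integral (p s) t) ->
  common_divisor lifted T d -> exists e,
  [/\ common_divisor lifted T e, lifted (e - d), p_integral (p s) e &
      forall r, S r -> p_integral (p r) d -> p_integral (p r) e].
Proof.
move=> Ss pT [ld dT].
have [z [n [lz pz Nn dE]]] := lifted_split Ss ld.
have [|| a [Na pna] amin] :=
    @least_in_residue_class [set a | N s a /\ (p s %| n + a)%N] (p s).
- move=> a b [_ pa] [_ pb]; apply/eqP; rewrite -(eqn_modDl n).
  by apply/eqP; rewrite (eqnP pa) (eqnP pb).
(* Adding this witness to [n] gives [p s * n], so the class opposite to [n] meets [N s]. *)
- exists ((p s).-1 * n)%N; split; first exact: NM.
  by rewrite -mulSn prednK ?prime_gt0 ?p_prime // dvdn_mulr.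
pose b := s / (p s)%:R * a%:R.
have lb : lifted b by apply: lifted_piece.
have pdb : p_integral (p s) (d + b).
  rewrite dE -addrA -mulrDr -natrD; have /dvdnP[c ->] := pna.
  rewrite piece_multiple //; apply: p_integralD => //; first exact: p_prime.
  by apply: M_p_integral => //; apply: MMn; apply: M_S.
exists (d + b); split=> //.
- split=> [|t Tt]; first exact: liftedD.
  have [z' [m [lz' pz' Nm tdE]]] := lifted_split Ss ((mdvdE _ _ _).1 (dT _ Tt)).
  (* Since [t] is integral at [p s], the class of [m] is opposite to that of [n]; hence [m] is [a]
     plus a multiple of [p s], and that multiple contributes only an element of [M]. *)
  have [|c mE] := amin m.
    split=> //; apply: (@p_integral_piece_dvdn s (z + z')) => //.
      by apply: p_integralD => //; apply: p_prime.
    have -> : z + z' + s / (p s)%:R * (n + m)%:R = t.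
      by rewrite natrD mulrDr addrACA -tdE -dE addrC subrK.
    exact: pT.
  apply/mdvdE; have -> : t - (d + b) = z' + s * c%:R.
    by rewrite -piece_multiple // opprD addrA tdE mE natrD /b; ring.
  by apply: liftedD => //; apply: M_lifted; apply: MMn; apply: M_S.
- by rewrite addrC addKr.
- move=> r Sr pd; have [-> //|rs] := eqVneq r s.
  by apply: p_integralD => //; [exact: p_prime | exact: piece_p_integral].
Qed.

(** The last clause keeps the induction going: primes already cleared stay integral while the others
    are treated. *)
Let clear_denominators (K : seq rat) T d : [set` K] `<=` S ->
  (forall s t, s \in K -> T t -> p_integral (p s) t) ->
  common_divisor lifted T d -> exists e,
  [/\ common_divisor lifted T e, lifted (e - d),
      {in K, forall s, p_integral (p s) e} &
      forall r, S r -> p_integral (p r) d -> p_integral (p r) e].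
Proof.
elim: K d => [|s K IHK] d.
  by exists d; split=> //; rewrite subrr; apply: submonoid0.
move=> /sub_consS[Ss KS] pT /(clear_denominator Ss)[t Tt|e [cd_e led pe pe']].
  by apply: pT; rewrite ?mem_head.
have [|f [cd_f lfe pf pf']] := IHK e KS _ cd_e.
  by move=> r t rK; apply: pT; rewrite inE rK orbT.
exists f; split=> //.
- have -> : f - d = (f - e) + (e - d) by ring.
  exact: liftedD.
- by move=> r; rewrite inE => /predU1P[->|/pf//]; apply: pf'.
- by move=> r Sr /(pe' _ Sr) /(pf' _ Sr).
Qed.

Let layered_common_divisor (L : seq rat) T d : [set` L] `<=` S -> uniq L -> T `<=` G L ->
  common_divisor lifted T d ->
  exists2 e, common_divisor (G L) T e & lifted (e - d).
Proof.
move=> LS uL TG cd_d; have /lifted_layered[L0 L0S GL0] := cd_d.1.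
(* Only the layers of [d] outside [L] need clearing, and elements of [T] are integral there because
   they lie in [G L]. The criterion then puts both [e] and its cofactors in [G L]. *)
pose K := [seq s <- L0 | s \notin L].
have KS : [set` K] `<=` S by move=> s /=; rewrite mem_filter => /andP[_ /L0S].
have [|e [[le eT] led pe pe']] := clear_denominators KS _ cd_d.
  move=> s t sK Tt; apply: layered_p_integral (TG _ Tt) => //; first exact: KS.
  by move: sK; rewrite mem_filter => /andP[].
have peL s : S s -> s \notin L -> p_integral (p s) e.
  move=> Ss sL; have [sL0|sL0] := boolP (s \in L0).
    by apply: pe; rewrite mem_filter sL.
  apply: pe' => //; apply: layered_p_integral sL0 _ => //.
  exact: GL0.
exists e => //; split=> [|t Tt]; first exact: lifted_p_integral_layered.
apply/mdvdE/lifted_p_integral_layered => // [|s Ss sL].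
  exact/mdvdE/eT.
apply: p_integralB; [exact: p_prime | | exact: peL].
exact: layered_p_integral (TG _ Tt).
Qed.

(** Integrality at the primes outside [L] survives subtraction, so divisibility between elements of
    [G L] is the same in [G L] and in [lifted]. *)
Let layered_subr L x y : [set` L] `<=` S -> uniq L -> G L x -> G L y ->
  lifted (x - y) -> G L (x - y).
Proof.
move=> LS uL Gx Gy lxy; apply: lifted_p_integral_layered => // s Ss sL.
by apply: p_integralB; [exact: p_prime | |]; apply: (layered_p_integral LS).
Qed.

(** * Transfer of MCDs between [M] and the lifting monoid *)

Let is_MCD_layered L T d : [set` L] `<=` S -> uniq L -> T `<=` G L ->
  is_MCD (G L) T d <-> is_MCD lifted T d.
Proof.
move=> LS uL TG.
have cdW e : common_divisor (G L) T e -> common_divisor lifted T e.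
  move=> [Ge eT]; split=> [|t Tt]; first exact: layered_lifted Ge.
  by apply/mdvdE; apply: (layered_lifted LS); apply/mdvdE; apply: eT.
rewrite !is_MCD_nonneg //; last exact: layered_nonneg.
split=> -[cd_d maxd].
  split=> [|d' cd_d' ld']; first exact: cdW.
  (* Push [d'] up to a common divisor [e] in [G L]. Maximality of [d] there gives [e = d], so [d'],
     lying between them, equals [d]. *)
  have [e cd_e led'] := layered_common_divisor LS uL TG cd_d'.
  have ed : e = d.
    apply: maxd => //; apply: layered_subr => //; [exact: cd_e.1|exact: cd_d.1|].
    have -> : e - d = (e - d') + (d' - d) by ring.
    exact: liftedD.
  have := lifted_nonneg.2 _ ld'; have := lifted_nonneg.2 _ led'.
  by rewrite ed /=; lra.
have [e cd_e led] := layered_common_divisor LS uL TG cd_d.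
(* Maximality of [d] in [lifted] means that enlarging it into [G L] changed nothing, so [d] was in
   [G L] already. *)
have ed : e = d by apply: maxd => //; apply: cdW.
rewrite ed in cd_e; split=> // d' cd_d' Gd'; apply: maxd; first exact: cdW.
exact: layered_lifted Gd'.
Qed.

(** Each layer multiplies the number of translates by [p s]: modulo [p s] there is one least element
    of [N s] per class, and any other element of the class differs from it by a multiple of [p s],
    which is absorbed by [M]. *)
Let layered_cover L : [set` L] `<=` S -> exists2 A : seq rat,
  {in A, forall a, G L a} &
  forall x, G L x -> exists2 a, a \in A & M (x - a).
Proof.
elim: L => [_|s L IHL /sub_consS[Ss LS]].
  exists [:: 0] => [a|x Mx]; first by rewrite inE => /eqP ->.
  by exists 0; rewrite ?mem_head ?subr0.
have [A AG cover] := IHL LS.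
have /choice[f fP] i : exists a, N s a /\
    forall m, N s m -> (m = i %[mod p s])%N -> exists c, m = (a + c * p s)%N.
  have [[m mQ]|noQ] := pselect ([set m | N s m /\ (m = i %[mod p s])%N] !=set0).
    have [||a [Na ai] amin] :=
        @least_in_residue_class [set m | N s m /\ (m = i %[mod p s])%N] (p s).
    - by move=> a b [_ ->] [_ ->].
    - by exists m.
    by exists a; split=> // b Nb bi; apply: amin.
  (* A class that misses [N s] gets the dummy representative 0, which still yields an element of
     [G (s :: L)]. *)
  exists 0%N; split=> [|m Nm mi]; first exact: N0.
  by case: noQ; exists m.
exists [seq a + s / (p s)%:R * (f i)%:R | a <- A, i <- iota 0 (p s)].
  move=> _ /allpairsP[[a i] /= [aA _ ->]]; exists a; first exact: AG.
  by exists (f i) => //; case: (fP i).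
move=> _ [z Gz [n Nn <-]]; have [a aA Mza] := cover _ Gz.
have [_ /(_ n Nn)[|c nE]] := fP (n %% p s)%N; first by rewrite modn_mod.
exists (a + s / (p s)%:R * (f (n %% p s)%N)%:R).
  apply/allpairsP; exists (a, n %% p s)%N; split=> //=.
  by rewrite mem_iota ltn_mod prime_gt0 ?p_prime.
have -> : z + s / (p s)%:R * n%:R - (a + s / (p s)%:R * (f (n %% p s)%N)%:R) =
    (z - a) + s * c%:R.
  by rewrite {1}nE natrD mulrDr piece_multiple //; ring.
by apply: MD => //; apply: MMn; apply: M_S.
Qed.

Lemma lifting_monoid_family_MCD k : family_MCD M k -> family_MCD lifted k.
Proof.
move=> famM t tl.
have /choice[L0 L0P] i : exists L0 : seq rat, [set` L0] `<=` S /\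
    forall L : seq rat, [set` L] `<=` S -> {subset L0 <= L} -> G L (t i).
  by have [L0 L0S GL0] := lifted_layered (tl i); exists L0.
(* One list serving all [t i] at once; duplicates go because the membership criterion requires
   distinct layers. *)
pose L := undup (flatten (codom L0)).
have LS : [set` L] `<=` S.
  move=> s /=; rewrite mem_undup => /flattenP[_ /codomP[i ->]].
  by have [+ _] := L0P i; apply.
have tG i : G L (t i).
  have [_ GL0] := L0P i; apply: GL0 => // s sL0.
  by rewrite mem_undup; apply/flattenP; exists (L0 i); rewrite ?codom_f.
have [A AG cover] := layered_cover LS.
have [|d dP] := family_MCD_finite_extension hM (layered_nonneg LS)
    (M_layered LS) _ AG cover famM tG.
  move=> x y Mx My /(layered_lifted LS) lxy.
  (* With no layers [G [::]] is [M] itself. *)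
  exact: (@layered_subr [::]).
exists d; apply/(is_MCD_layered _ LS) => //; first exact: undup_uniq.
by move=> _ [i _ <-].
Qed.

Lemma lifting_monoid_kMCD k : kMCD lifted k -> kMCD M k.
Proof.
move=> kl T TM Tk; have [|//|d dP] := kl T; first by move=> x /TM /M_lifted.
by exists d; apply/(@is_MCD_layered [::]).
Qed.

End Lifting.

Theorem lemma4p1 (M S : set rat) (phi : rat -> nat * set nat)
    (hM : sparing M) (hphi : lifting_function M S phi)
    (k : nat) (hk : (0 < k)%N) :
  kMCD M k <-> kMCD (lifting_monoid M S phi) k.
Proof.
have [M_submonoid M_ge0 M_nontriv _] := hM.
have M_nonneg : nonneg_submonoid M by split.
split; last exact: lifting_monoid_kMCD.
move=> /(kMCD_family_MCD M_nonneg M_nontriv hk) famM.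
exact/family_MCD_kMCD/lifting_monoid_family_MCD.
Qed.
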